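(* Let $b=3$. For every $n\ge2$, $$B(n)=\frac{K(\lceil n/2\rceil)+K(\lfloor n/2\rfloor)+2}{2},\qquad K(n)=3^{B(n)}+1+K(\lfloor n/2\rfloor),$$ and $K(n)>3K(n-1)$.
   Context: Base $b=3$. For $v\in\mathbb{N}$, $s(v)$ is the sum of the base-3 digits of $v$, $f(v)=v+s(v)$, and $F(u)=|\{v\in\mathbb{N}: f(v)=u\}|$. $K(n)$ is the smallest $u\in\mathbb{N}$ with $F(u)=n$ (so $K(1)=0$), and for $n\ge2$, $B(n)=\lfloor\log_3 K(n)\rfloor$. *)

(* Defs.v *)
From mathcomp Require Import all_boot all_order all_algebra.
From mathcomp Require Import zify.

Set Implicit Arguments.
Unset Strict Implicit.
Unset Printing Implicit Defensive.

(* The digit of index i of v is v %/ 3 ^ i %% 3; since v < 3 ^ v, all the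
   digits of index i >= v are zero. *)
Definition s (v : nat) : nat := \sum_(i < v) v %/ 3 ^ i %% 3.

Definition f (v : nat) : nat := v + s v.

(* Searching up to u suffices because v <= f v; see mem_generators. *)
Definition generators (u : nat) : seq nat := [seq v <- iota 0 u.+1 | f v == u].

Lemma mem_generators u v : (v \in generators u) = (f v == u).
Proof.
rewrite mem_filter mem_iota /= add0n andb_idr // => /eqP <-.
by rewrite ltnS leq_addr.
Qed.

Lemma generators_uniq u : uniq (generators u).
Proof. exact/filter_uniq/iota_uniq. Qed.

Definition F (u : nat) : nat := size (generators u).

Lemma s_bound m v : v < 3 ^ m -> s v = \sum_(i < m) v %/ 3 ^ i %% 3.
Proof.
have ext k N : k <= N -> v < 3 ^ k ->
    \sum_(i < k) v %/ 3 ^ i %% 3 = \sum_(i < N) v %/ 3 ^ i %% 3.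
  move=> kN vk; rewrite (big_ord_widen N (fun i => v %/ 3 ^ i %% 3) kN).
  rewrite big_mkcond; apply: eq_bigr => i _; case: ltnP => // ki.
  by rewrite divn_small ?mod0n // (leq_trans vk) // leq_exp2l.
move=> vm; have vv : v < 3 ^ v by apply: ltn_expl.
rewrite /s; case: (leqP v m) => [vm'|/ltnW mv]; first by rewrite (ext v m).
by rewrite (ext m v).
Qed.

Lemma s_rec v : s v = v %% 3 + s (v %/ 3).
Proof.
have vv : v < 3 ^ v by apply: ltn_expl.
rewrite (@s_bound v.+1 v); last by rewrite expnS; lia.
rewrite (@s_bound v (v %/ 3)); last by lia.
rewrite big_ord_recl expn0 divn1; congr (_ + _); apply: eq_bigr => i _.
by rewrite expnS divnMA.
Qed.

Lemma odd_s v : odd (s v) = odd v.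
Proof.
elim/ltn_ind: v => v IH; case: v IH => [|v] IH; first by rewrite /s big_ord0.
rewrite s_rec oddD IH; last by lia.
lia.
Qed.

Lemma f_even v : ~~ odd (f v).
Proof. by rewrite oddD odd_s addbb. Qed.

Lemma s_high m w : w < 3 ^ m -> s (3 ^ m + w) = (s w).+1.
Proof.
elim: m w => [|m IH] w.
  by rewrite expn0 ltnS leqn0 => /eqP->; rewrite /s big_ord1 big_ord0.
rewrite expnS => wm; rewrite s_rec (s_rec w).
have -> : (3 * 3 ^ m + w) %/ 3 = 3 ^ m + w %/ 3 by lia.
by rewrite IH; lia.
Qed.

Lemma s_compl m w : w < 3 ^ m -> s (3 ^ m - w.+1) + s w = m.*2.
Proof.
elim: m w => [|m IH] w.
  by rewrite expn0 ltnS leqn0 => /eqP->; rewrite /s !big_ord0.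
rewrite expnS => wm; rewrite s_rec (s_rec w).
have -> : (3 * 3 ^ m - w.+1) %/ 3 = 3 ^ m - (w %/ 3).+1 by lia.
by have := IH (w %/ 3); lia.
Qed.

Lemma F_sum N u : u < N -> F u = \sum_(v < N) (f v == u).
Proof.
move=> uN; rewrite -(big_mkord xpredT (fun v => (f v == u) : nat)).
rewrite (big_cat_nat (n := u.+1)) //= [X in _ = _ + X]big_nat_cond.
rewrite [X in _ = _ + X]big1 => [|v]; last by rewrite /f; lia.
by rewrite addn0 /F size_filter -sum1_count big_mkcond /index_iota subn0.
Qed.

Lemma F_split m c d :
  c + d + 2 = m.*2 -> F (3 ^ m + 1 + c) = F c + F d.
Proof.
move=> cdm; have m3 : m.*2 <= 3 ^ m.
  by elim: m {cdm} => // m IH; rewrite expnS; have := expn_gt0 3 m; lia.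
rewrite (@F_sum (3 ^ m + 3 ^ m)); last by lia.
rewrite (@F_sum (3 ^ m) c) ?(@F_sum (3 ^ m) d); try lia.
rewrite big_split_ord /= addnC; congr (_ + _).
  by apply: eq_bigr => w _; rewrite /f s_high //; congr nat_of_bool; lia.
rewrite (reindex_inj rev_ord_inj); apply: eq_bigr => w _ /=.
by have := s_compl (ltn_ord w); have := ltn_ord w; rewrite /f => ? ?;
  congr nat_of_bool; lia.
Qed.

Lemma F_surj n : exists u, F u == n.
Proof.
have s0 : s 0 = 0 by rewrite /s big_ord0.
have s1 : s 1 = 1 by rewrite /s big_ord1.
elim/ltn_ind: n => -[|[|n]] IH.
- by exists 1; rewrite (@F_sum 2) // !big_ord_recl big_ord0 /= /f s0 s1.
- by exists 0; rewrite (@F_sum 1) // big_ord1 /= /f s0.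
have ev u : 0 < F u -> ~~ odd u.
  rewrite /F -has_predT => /hasP[v].
  by rewrite mem_generators => /eqP <- _; exact: f_even.
have [c /eqP cP] := IH n.+2./2 ltac:(lia).
have [d /eqP dP] := IH (uphalf n.+2) ltac:(lia).
have := ev c; have := ev d; rewrite cP dP => /(_ isT) do_ /(_ isT) co_.
exists (3 ^ (c + d + 2)./2 + 1 + c).
by rewrite (@F_split _ c d) ?cP ?dP; lia.
Qed.

Definition K (n : nat) : nat := ex_minn (F_surj n).

(* K n > 0 for n <> 1, so trunc_log is the floor of log_3 there; B 1 is the
   default value 0. *)
Definition B (n : nat) : nat := trunc_log 3 (K n).

(* Main.v *)
(* Put u = K n and 3 ^ m <= u < 3 ^ m.+1.  Splitting the generators of u by
   their leading base-3 digit, and reflecting the block below a multiple of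
   3 ^ m, expresses F u through F at much smaller arguments.  In all cases but
   u = 3 ^ m + 1 + c with c + d + 2 = 2 m this produces a smaller number with
   the same F, so minimality leaves only that case, where F u = F c + F d.
   Hence u minimises 3 ^ m + 1 + c over F c + F d = n, and the growth
   K (k + 1) > 3 K k for k + 1 < n forces the balanced choice
   c = K (floor (n / 2)), d = K (ceil (n / 2)). *)
Require Import Defs.
From mathcomp Require Import all_boot all_order all_algebra.
From mathcomp Require Import zify.

Set Implicit Arguments.
Unset Strict Implicit.
Unset Printing Implicit Defensive.

(** * Counting generators by leading digit *)

Lemma double_lt_exp3 m : m.*2 < 3 ^ m.
Proof. by elim: m => // m IH; rewrite expnS; lia. Qed.

Lemma f_upper m v : v < 3 ^ m -> f v < 3 ^ m + m.*2.
Proof. by move=> vm; have := s_compl vm; rewrite /f; lia. Qed.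

Lemma f_digit1 m w : w < 3 ^ m -> f (3 ^ m + w) = 3 ^ m + 1 + f w.
Proof. by move=> wm; rewrite /f s_high //; lia. Qed.

(** Complementing [w] on [m] digits and then on [m.+1] digits prefixes a 2; the complementary digit
    sums [m.*2] and [m.+1.*2] differ by that 2. *)
Lemma f_digit2 m w : w < 3 ^ m -> f (2 * 3 ^ m + w) = 2 * 3 ^ m + 2 + f w.
Proof.
move=> wm; have := s_compl wm.
have /s_compl : 3 ^ m - w.+1 < 3 ^ m.+1 by rewrite expnS; lia.
have -> : 3 ^ m.+1 - (3 ^ m - w.+1).+1 = 2 * 3 ^ m + w by rewrite expnS; lia.
by rewrite /f; lia.
Qed.

Lemma F_odd u : odd u -> F u = 0.
Proof.
move=> ou; apply/eqP; rewrite -leqn0 leqNgt /F -has_predT.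
apply/hasPn => v; rewrite mem_generators => /eqP uE.
by have := f_even v; rewrite uE ou.
Qed.

(** Blocks 0, 1, 2 collect the [v] with that digit at index [m]. *)
Lemma F_blocks m u : u < 3 ^ m.+1 ->
  F u = \sum_(w < 3 ^ m) (f w == u) + \sum_(w < 3 ^ m) (3 ^ m + 1 + f w == u)
        + \sum_(w < 3 ^ m) (2 * 3 ^ m + 2 + f w == u).
Proof.
move=> um; rewrite (@F_sum (3 ^ m + 3 ^ m + 3 ^ m)); last by rewrite expnS in um; lia.
rewrite !big_split_ord /=; congr (_ + _ + _); apply: eq_bigr => w _.
  by rewrite f_digit1.
by rewrite addnn -mul2n f_digit2.
Qed.

(** Under [w -> 3 ^ m - w.+1], the two values of [f] add up to [3 ^ m + m.*2 - 1]. *)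
Lemma sum_reflect m x : \sum_(w < 3 ^ m) (f w == x) =
  \sum_(w < 3 ^ m) ((f w + x).+1 == 3 ^ m + m.*2).
Proof.
rewrite (reindex_inj rev_ord_inj); apply: eq_bigr => w _ /=.
by have := s_compl (ltn_ord w); have := ltn_ord w; rewrite /f => ? ?;
  congr nat_of_bool; lia.
Qed.

(** Block 0 ends below the argument by [f_upper] and block 2 starts above it, so only block 1
    counts. *)
Lemma F_tail1 m c : m.*2 < c + 2 -> c.+1 < 3 ^ m -> F (3 ^ m + 1 + c) = F c.
Proof.
move=> mc cm; rewrite (@F_blocks m) ?expnS; last by lia.
rewrite big1 => [|w _]; last by have := f_upper (ltn_ord w); lia.
rewrite [X in _ + X]big1 => [|w _]; last by lia.
rewrite add0n addn0 (@F_sum (3 ^ m)); last by lia.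
by apply: eq_bigr => w _; congr nat_of_bool; lia.
Qed.

Lemma F_tail2 m c : m.*2 < c + 2 -> c.+2 < 3 ^ m -> F (2 * 3 ^ m + 2 + c) = F c.
Proof.
move=> mc cm; rewrite (@F_blocks m) ?expnS; last by lia.
have m3 := double_lt_exp3 m.
rewrite big1 => [|w _]; last by have := f_upper (ltn_ord w); lia.
rewrite big1 => [|w _]; last by have := f_upper (ltn_ord w); lia.
rewrite !add0n (@F_sum (3 ^ m)); last by lia.
by apply: eq_bigr => w _; congr nat_of_bool; lia.
Qed.

(** Block 2 gives [F c] and block 1, reflected, gives [F d]. The smaller argument of [F_split] has
    the same value, so [K n] never has this form. *)
Lemma F_split2 m c d : c + d + 2 = m.*2 -> F (2 * 3 ^ m + 2 + c) = F c + F d.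
Proof.
move=> cdm; have m3 := double_lt_exp3 m.
rewrite (@F_blocks m) ?expnS; last by lia.
rewrite big1 => [|w _]; last by have := f_upper (ltn_ord w); lia.
rewrite add0n addnC (@F_sum (3 ^ m) c) ?(@F_sum (3 ^ m) d); try lia.
congr (_ + _); first by apply: eq_bigr => w _; congr nat_of_bool; lia.
by rewrite sum_reflect; apply: eq_bigr => w _; congr nat_of_bool; lia.
Qed.

(** This is the one even argument lying between the forms [3 ^ m + 1 + c] with leading digit 1 and
    [2 * 3 ^ m + 2 + c]. *)
Lemma F_double_exp3 m : F (2 * 3 ^ m) = F m.*2.
Proof.
have m3 := double_lt_exp3 m.
rewrite (@F_blocks m) ?expnS; last by lia.
rewrite big1 => [|w _]; last by have := f_upper (ltn_ord w); lia.
rewrite [X in _ + X]big1 => [|w _]; last by lia.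
rewrite add0n addn0 (@F_sum (3 ^ m)) // sum_reflect.
by apply: eq_bigr => w _; congr nat_of_bool; lia.
Qed.

(** * The shape of [K n] forced by minimality *)

Lemma F_K n : F (K n) = n.
Proof. by rewrite /K; case: ex_minnP => u /eqP. Qed.

Lemma K_min n u : F u = n -> K n <= u.
Proof. by move=> Fu; rewrite /K; case: ex_minnP => w _; apply; apply/eqP. Qed.

Lemma K_even n : 0 < n -> ~~ odd (K n).
Proof. by apply: contraL => /F_odd; rewrite F_K => ->. Qed.

Lemma K1 : K 1 = 0.
Proof.
apply/eqP; rewrite -leqn0 K_min // (@F_sum 1) // big_ord1.
by rewrite /f /s big_ord0.
Qed.

Lemma K_shape n : 1 < n ->
  exists m c d, [/\ K n = 3 ^ m + 1 + c, c + d + 2 = m.*2 & n = F c + F d].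
Proof.
move=> n1; have K0 : 0 < K n.
  rewrite lt0n; apply: contraTneq n1 => Kn0; rewrite -(F_K n) Kn0.
  by rewrite -K1 F_K.
have Ke := K_even (ltnW n1); have Fn := F_K n.
have smaller x : F x = n -> K n <= x := @K_min n x.
have [m1 m2] : 3 ^ trunc_log 3 (K n) <= K n /\ K n < 3 ^ (trunc_log 3 (K n)).+1.
  by split; [apply: trunc_logP | apply: trunc_log_ltn].
move: (trunc_log _ _) m1 m2 => m m1; rewrite expnS => m2.
have m3 := double_lt_exp3 m.
have o3 : odd (3 ^ m) by rewrite oddX orbT.
have [lt2|ge2] := ltnP (K n) (2 * 3 ^ m).
  (* [K n] is even and [3 ^ m] is odd, so they differ. *)
  have [c KE] : exists c, K n = 3 ^ m + 1 + c.
    by exists (K n - (3 ^ m + 1)); lia.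
  have [mc|cm] := ltnP m.*2 (c + 2).
    rewrite KE F_tail1 // in Fn; last by lia.
    by have := smaller _ Fn; lia.
  exists m, c, (m.*2 - (c + 2)); have cdE : c + (m.*2 - (c + 2)) + 2 = m.*2 by lia.
  by split=> //; rewrite -(F_split cdE) -KE.
have [KE|neK] := eqVneq (K n) (2 * 3 ^ m).
  rewrite KE F_double_exp3 in Fn.
  by have := smaller _ Fn; lia.
have [c KE] : exists c, K n = 2 * 3 ^ m + 2 + c.
  by exists (K n - (2 * 3 ^ m + 2)); lia.
have [mc|cm] := ltnP m.*2 (c + 2).
  rewrite KE F_tail2 // in Fn; last by lia.
  by have := smaller _ Fn; lia.
have cdE : c + (m.*2 - (c + 2)) + 2 = m.*2 by lia.
rewrite KE (F_split2 cdE) -(F_split cdE) in Fn.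
by have := smaller _ Fn; lia.
Qed.

(** * Balanced splitting and the recursion *)

Lemma homo_leq_bounded (g : nat -> nat) N :
  (forall k, 0 < k < N -> g k <= g k.+1) ->
  forall i j, 0 < i -> i <= j -> j <= N -> g i <= g j.
Proof.
move=> incr i; elim=> [|j IH] i0 ij jN; first by lia.
have [->//|nij] := eqVneq i j.+1.
by apply: leq_trans (IH _ _ _) (incr j _); lia.
Qed.

Lemma K_balanced n m : 1 < n ->
    m.*2 = K (uphalf n) + K n./2 + 2 ->
    (forall k, 0 < k < n.-1 -> 3 * K k < K k.+1) ->
  K n = 3 ^ m + 1 + K n./2.
Proof.
move=> n1 mE grow.
(* Index 0 must be left out: [K 0 = 1] exceeds [K 1 = 0]. *)
have mono i j : 0 < i -> i <= j -> j < n -> K i <= K j.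
  by move=> i0 ij jn; apply: (@homo_leq_bounded K n.-1) => // [k /grow|]; lia.
have Kle : K n <= 3 ^ m + 1 + K n./2.
  by apply: K_min; rewrite (@F_split m _ (K (uphalf n))) ?F_K; lia.
have [m' [c [d [KE cdE nE]]]] := K_shape n1.
have m3 := double_lt_exp3 m'; have m4 := double_lt_exp3 m.
(* If one part counted 0, the other would be a number below [K n] with [n] generators. *)
have d0 : 0 < F d.
  by rewrite lt0n; apply/eqP => Fd; have := @K_min n c; lia.
have c0 : 0 < F c.
  by rewrite lt0n; apply/eqP => Fc; have := @K_min n d; lia.
have Kc : K (F c) <= c by exact: K_min.
have Kd : K (F d) <= d by exact: K_min.
have m'm : m' <= m.
  rewrite leqNgt; apply/negP => mm'.
  have : 3 ^ m.+1 <= 3 ^ m' by rewrite leq_exp2l.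
  by rewrite expnS; lia.
have Kpq : K n./2 <= K (uphalf n) by apply: mono; lia.
(* Otherwise [K x] exceeds [3 * K (uphalf n)], while [m' <= m] leaves it at most [2 * K (uphalf n)].
   Since [0 < y], [x] stays below [n], where [grow] applies. *)
have at_most_half x y : x + y = n -> 0 < y -> K x + K y + 2 <= m'.*2 -> x <= uphalf n.
  move=> xy y0 Kxy; rewrite leqNgt; apply/negP => qx.
  have g : 3 * K (uphalf n) < K (uphalf n).+1 by apply: grow; lia.
  have : K (uphalf n).+1 <= K x by apply: mono; lia.
  lia.
have cq : F c <= uphalf n by apply: (at_most_half _ (F d)); lia.
have dq : F d <= uphalf n by apply: (at_most_half _ (F c)); lia.
have Kpc : K n./2 <= K (F c) by apply: mono; lia.
have Kpd : K n./2 <= K (F d) by apply: mono; lia.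
have mm' : m <= m'.
  have [E|E] : F c = uphalf n \/ F d = uphalf n by lia.
    by rewrite E in Kc; lia.
  by rewrite E in Kd; lia.
have E : m' = m by lia.
by rewrite E in KE; lia.
Qed.

Lemma K_rec n : 1 < n ->
  [/\ (B n).*2 = K (uphalf n) + K n./2 + 2,
      K n = 3 ^ B n + 1 + K n./2 & 3 * K n.-1 < K n].
Proof.
elim/ltn_ind: n => n IH n1.
have formula k : 1 < k <= n ->
    (B k).*2 = K (uphalf k) + K k./2 + 2 /\ K k = 3 ^ B k + 1 + K k./2.
  move=> /andP[k1 kn]; have [{}kn|nk] := ltnP k n; first by case: (IH k).
  have -> : k = n by lia.
  (* Evenness of both values makes the halving exact. *)
  have e1 := @K_even (uphalf n) ltac:(lia); have e2 := @K_even n./2 ltac:(lia).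
  have mE : ((K (uphalf n) + K n./2 + 2)./2).*2 = K (uphalf n) + K n./2 + 2.
    by lia.
  have KE := @K_balanced n _ n1 mE _.
  have {}KE : K n = 3 ^ (K (uphalf n) + K n./2 + 2)./2 + 1 + K n./2.
    by apply: KE => j jn; have [] := IH j.+1 ltac:(lia) ltac:(lia).
  suff -> : B n = (K (uphalf n) + K n./2 + 2)./2 by [].
  apply: trunc_log_eq => //; rewrite KE expnS.
  have := double_lt_exp3 (K (uphalf n) + K n./2 + 2)./2.
  have : K n./2 <= K (uphalf n).
    have [->//|ne] := eqVneq n./2 (uphalf n).
    have -> : n./2 = (uphalf n).-1 by lia.
    by have [_ _] := IH (uphalf n) ltac:(lia) ltac:(lia); lia.
  by lia.
have [Bn Kn] := formula n ltac:(lia); split=> //.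
(* [n = 2] is separate, since [B 1] is only a default value. *)
have [n2|n3] := leqP n 2.
  have -> : n.-1 = 1 by lia.
  by rewrite K1; lia.
have [Bn' Kn'] := formula n.-1 ltac:(lia).
have gap k : 0 < k -> k.+1 < n -> K k + 4 <= K k.+1.
  move=> k0 kn; have [Bk Kk gr] := IH k.+1 kn ltac:(lia).
  have := K_even k0; have := @K_even k.+1 isT.
  have : 3 ^ 1 <= 3 ^ B k.+1 by rewrite leq_exp2l; lia.
  move: gr => /=; lia.
(* From [n.-1] to [n] one half moves to its successor, so by [gap] the doubled exponent grows by at
   least 4. *)
have B2 : (B n.-1).+2 <= B n.
  have [on|en] := boolP (odd n).
    have := gap n./2 ltac:(lia) ltac:(lia).
    have -> : n./2.+1 = uphalf n by lia.
    have E1 : n.-1./2 = n./2 by lia.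
    have E2 : uphalf n.-1 = n./2 by lia.
    by rewrite E1 E2 in Bn'; lia.
  have := gap n./2.-1 ltac:(lia) ltac:(lia).
  have -> : n./2.-1.+1 = n./2 by lia.
  have E0 : uphalf n = n./2 by lia.
  have E1 : n.-1./2 = n./2.-1 by lia.
  have E2 : uphalf n.-1 = n./2 by lia.
  by rewrite E1 E2 in Bn'; rewrite E0 in Bn; lia.
(* The factor 9 suffices because [K n.-1] is below [2 * 3 ^ B n.-1]. *)
have : 3 ^ (B n.-1).+2 <= 3 ^ B n by rewrite leq_exp2l.
have := double_lt_exp3 (B n.-1).
have : K n.-1./2 <= (B n.-1).*2 - 2 by lia.
by rewrite !expnS; lia.
Qed.

Theorem theorem5p2 (n : nat) (hn : 2 <= n) :
  [/\ ((B n)%:R = ((K (uphalf n))%:R + (K n./2)%:R + 2) / 2 :> rat)%R,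
      K n = 3 ^ B n + 1 + K n./2
    & K n > 3 * K (n - 1)].
Proof.
have [Bn Kn gr] := K_rec hn; split=> //; last by rewrite subn1.
have -> : ((K (uphalf n))%:R + (K n./2)%:R + 2 = (B n)%:R * 2 :> rat)%R.
  by rewrite -!GRing.natrD -GRing.natrM -Bn muln2.
by rewrite GRing.mulfK.
Qed.
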